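(* Let $m\in\mathbb N$, $n\in\mathbb N^m$, and let $M\in\mathbb N_0^n$ be a principal reversible cuboid. Then there exist $L\in\mathbb N_0$ and numbers $j_l\in\{1,\dots,m\}$, $f_l\in\mathbb N+1$ ($l\in\{1,\dots,L\}$) such that $\prod_{l:\,j_l=j}f_l=n_j$ for every $j\in\{1,\dots,m\}$ and \[M={\cal B}_{j_L,f_L}\circ{\cal B}_{j_{L-1},f_{L-1}}\circ\dots\circ{\cal B}_{j_1,f_1}((0)),\] where $(0)\in\mathbb N_0^{1_m}$ is the trivial cuboid with single entry $0$. Moreover, these may be chosen such that $j_l\ne j_{l-1}$ for all $l\in\{2,\dots,L\}$.
   Context: $\mathbb N=\{1,2,\dots\}$, $\mathbb N_0=\mathbb N\cup\{0\}$, $\mathbb N+1=\{2,3,\dots\}$, $\langle N\rangle=\{0,\dots,N-1\}$. For $n\in\mathbb N^m$, a cuboid (tensor) $M\in\mathbb N_0^n$ is a family of entries $M_k\in\mathbb N_0$ indexed by $k\in\mathbb N^m$, $k\le n$ componentwise; $1_m=(1,\dots,1)$, $e_j$ the $j$-th unit vector. Property (V): for all $1\le i<j\le m$ and all index vectors in range, $M_{k_1,\dots,k_i,\dots,k_j,\dots,k_m}+M_{k_1,\dots,k_i',\dots,k_j',\dots,k_m}=M_{k_1,\dots,k_i,\dots,k_j',\dots,k_m}+M_{k_1,\dots,k_i',\dots,k_j,\dots,k_m}$ (vacuous if $m=1$). $M$ is a principal reversible cuboid if it has (V), its set of entries is $\langle\prod_j n_j\rangle$, and $M_k<M_{k+le_j}$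 whenever $1\le l\le n_j-k_j$ (dimensions $n_j=1$ allowed). Direction-$j$ Kronecker product: for $v\in\mathbb N_0^k$ and $M\in\mathbb N_0^n$, $v\otimes_jM\in\mathbb N_0^{n+(k-1)n_je_j}$ is defined by $(v\otimes_jM)_{\hat n+ln_je_j}=v_{l+1}M_{\hat n}$ ($\hat n\le n$, $l\in\langle k\rangle$). Let $\overrightarrow{\langle k\rangle}=(0,1,\dots,k-1)$, $1_k$ the all-ones vector of length $k$, $1_{[n]}$ the all-ones cuboid of dimension $n$. The building operator is ${\cal B}_{j,k}(M)=\bigl(\prod_{r=1}^m n_r\bigr)\overrightarrow{\langle k\rangle}\otimes_j1_{[n]}+1_k\otimes_jM\in\mathbb N_0^{n+(k-1)n_je_j}$ for $M\in\mathbb N_0^n$. An empty composition ($L=0$) is the identity. *)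

(* Defs.v *)
From mathcomp Require Import all_boot.
Set Implicit Arguments. Unset Strict Implicit. Unset Printing Implicit Defensive.

Definition dims (m : nat) := {ffun 'I_m -> nat}.

(* Indices are 0-based: the coordinate k_j in {1, ..., n_j} is represented by
   the ordinal k_j - 1 in 'I_(n j). *)
Definition cindex (m : nat) (n : dims m) := {dffun forall j : 'I_m, 'I_(n j)}.

Definition cuboid (m : nat) (n : dims m) := {ffun cindex n -> nat}.

Definition set_coord (m : nat) (n : dims m) (k : cindex n) (j : 'I_m)
    (a : 'I_(n j)) : cindex n :=
  finfun (dfwith k a).

Definition propertyV (m : nat) (n : dims m) (M : cuboid n) : Prop :=
  forall (i j : 'I_m), i < j ->
  forall (k : cindex n) (a : 'I_(n i)) (b : 'I_(n j)),
    M k + M (set_coord (set_coord k a) b) =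
    M (set_coord k b) + M (set_coord k a).

(* In the last clause a plays the role of k_j + l with 1 <= l <= n_j - k_j. *)
Definition principal_reversible (m : nat) (n : dims m) (M : cuboid n) : Prop :=
  [/\ propertyV M,
      forall x : nat, (exists k : cindex n, M k = x) <-> x < \prod_j n j &
      forall (k : cindex n) (j : 'I_m) (a : 'I_(n j)),
        k j < a -> M k < M (set_coord k a)].

(* n + (k - 1) n_j e_j, for k >= 1 *)
Definition kron_dims (m : nat) (n : dims m) (j : 'I_m) (k : nat) : dims m :=
  [ffun i => if i == j then k * n j else n i].

Lemma kron_dims_modn (m : nat) (n : dims m) (j : 'I_m) (k : nat)
    (p : cindex (kron_dims n j k)) (i : 'I_m) : p i %% n i < n i.
Proof.
rewrite ltn_mod; have: 0 < kron_dims n j k i by exact: leq_ltn_trans (ltn_ord (p i)).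
rewrite ffunE; case: eqP => [->|_] //.
by case: (n j) => //; rewrite muln0.
Qed.

(* An index p of v \otimes_j M is uniquely q + l n_j e_j with q an index of M
   and l < k: q_i = p_i %% n_i (which is p_i for i != j) and l = p_j %/ n_j;
   see kronE. *)
Definition kron_index (m : nat) (n : dims m) (j : 'I_m) (k : nat)
    (p : cindex (kron_dims n j k)) : cindex n :=
  [ffun i : 'I_m => Ordinal (kron_dims_modn p i)].

Definition kron (m : nat) (n : dims m) (j : 'I_m) (k : nat)
    (v : k.-tuple nat) (M : cuboid n) : cuboid (kron_dims n j k) :=
  [ffun p : cindex (kron_dims n j k) =>
     nth 0 v (p j %/ n j) * M (kron_index p)].

Lemma kronE (m : nat) (n : dims m) (j : 'I_m) (k : nat) (v : k.-tuple nat)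
    (M : cuboid n) (q : cindex n) (l : 'I_k) (p : cindex (kron_dims n j k)) :
  (forall i, p i = q i + (if i == j then l * n j else 0) :> nat) ->
  kron j v M p = tnth v l * M q.
Proof.
move=> pE; rewrite ffunE; congr (_ * M _).
  rewrite (tnth_nth 0); congr nth; have lt_q := ltn_ord (q j).
  rewrite pE eqxx addnC divnMDl ?divn_small ?addn0 //.
  exact: leq_ltn_trans lt_q.
apply/ffunP => i; apply/val_inj; rewrite ffunE /= pE.
case: eqP => [->|_]; last by rewrite addn0 modn_small.
by rewrite addnC modnMDl modn_small.
Qed.

Definition building (m : nat) (n : dims m) (j : 'I_m) (k : nat)
    (M : cuboid n) : cuboid (kron_dims n j k) :=
  [ffun p => (\prod_r n r) * kron j (iota_tuple k 0) [ffun _ : cindex n => 1] p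
             + kron j (nseq_tuple k 1) M p].

(* Building changes the dimensions, so compositions of building operators are
   formed on cuboids packed with their dimension vector. *)
Definition packed_cuboid (m : nat) := {n : dims m & cuboid n}.

Definition pack (m : nat) (n : dims m) (M : cuboid n) : packed_cuboid m :=
  existT (@cuboid m) n M.

Definition packed_building (m : nat) (C : packed_cuboid m) (jk : 'I_m * nat) :
    packed_cuboid m :=
  pack (building jk.1 jk.2 (tagged C)).

(* B_{j_L, f_L} o ... o B_{j_1, f_1} *)
Definition building_comp (m L : nat) (j : 'I_L -> 'I_m) (f : 'I_L -> nat)
    (C : packed_cuboid m) : packed_cuboid m :=
  foldl (@packed_building m) C [seq (j l, f l) | l <- enum 'I_L].

Definition trivial_cuboid (m : nat) : cuboid ([ffun _ => 1] : dims m) :=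
  [ffun _ => 0].

(* Main.v *)
Require Import Defs.
From mathcomp Require Import all_boot zify.
Set Implicit Arguments. Unset Strict Implicit. Unset Printing Implicit Defensive.

(** Property (V) makes the entries of [M] sums of the values [g_i] on the axes,
    so the sets [A_i] of axis values sum directly to an initial segment.  If
    [1] lies in [A_j] and [f] is the first number missing from [A_j], then, as
    in de Bruijn's theorem on additive number systems, [A_j] is a union of
    blocks [[q f, q f + f)] and all other [A_i] consist of multiples of [f].
    Dividing by [f] yields a smaller system; this removes the innermost building
    operator, in direction [j] with factor [f].  After the division [1] no longer
    belongs to [A_j], so consecutive directions differ. *)

(** * Blocks in direct sums and in increasing enumerations *)

Section DirectSum.

Variables (A B : nat -> Prop) (f : nat).
Hypotheses (A0 : A 0) (B0 : B 0).
Hypothesis AB_inj :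
  forall a b a' b', A a -> B b -> A a' -> B b' -> a + b = a' + b' -> a = a'.
Hypothesis AB_down : forall a b x, A a -> B b -> x <= a + b ->
  exists a' b', [/\ A a', B b' & x = a' + b'].
Hypotheses (A_initial : forall r, r < f -> A r) (A_notf : ~ A f).

(** Strong induction on [q]. If block [q] meets [A] or [B], then [q * f] is itself a sum [a + b];
    comparing this representation with those of the numbers [q * f + r] decides what the block
    contains. *)
Lemma direct_sum_block q :
  (forall r, r < f -> B (q * f + r) -> r = 0) /\
  (forall r r', r < f -> r' < f -> A (q * f + r) -> A (q * f + r')).
Proof.
have B_small b : B b -> b < f -> b = 0.
  by move=> Bb /A_initial Ab; have := AB_inj A0 Bb Ab B0; lia.
elim/ltn_ind: q => q IH.
case: (posnP q) => [->|q_gt0].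
  split=> [r ltr Br|r r' _ ltr' _]; last exact: A_initial.
  exact: (B_small).
have blockE x : x = x %/ f * f + x %% f by exact: divn_eq.
have B_dvd b : B b -> b < q * f -> b = b %/ f * f.
  move=> Bb ltb; have f_gt0 : 0 < f by lia.
  have ltq : b %/ f < q by rewrite ltn_divLR.
  have := (IH _ ltq).1 (b %% f); rewrite -blockE ltn_mod => /(_ f_gt0 Bb) r0.
  by rewrite {1}(blockE b) r0 addn0.
have A_block a r : A (a * f) -> a < q -> r < f -> A (a * f + r).
  move=> Aa lta ltr; have := (IH a lta).2 0 r; rewrite addn0; apply=> //; lia.
(* A block that meets neither set satisfies both claims trivially, so an element of it may be
   assumed. *)
have key r0 : r0 < f -> A (q * f + r0) \/ B (q * f + r0) ->
  (forall r, r < f -> B (q * f + r) -> r = 0) /\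
  (forall r r', r < f -> r' < f -> A (q * f + r) -> A (q * f + r')).
  move=> ltr0 AorB; have f_gt0 : 0 < f by lia.
  have [a [b [Aa Bb abE]]] : exists a b, [/\ A a, B b & q * f = a + b].
    case: AorB => [Ax|Bx].
      by apply: (AB_down Ax B0); lia.
    by apply: (AB_down A0 Bx); lia.
  (* If [b > 0], then [q * f + r = (a + r) + b] with [a + r] in [A]. Uniqueness leaves no element of
     [A] in the block, and none of [B] except possibly [q * f]. *)
  have [b0|b_gt0] := posnP b; last first.
    have [b_lt|b_ge] := ltnP b (q * f); last first.
      have a0 : a = 0 by lia.
      have bE : b = q * f by lia.
      subst a b; split=> [r ltr Br|r r' ltr _ Ar].
        by have := AB_inj (A_initial ltr) Bb A0 Br; lia.
      by have := AB_inj (A_initial ltr) Bb Ar B0; lia.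
    have bE := B_dvd _ Bb b_lt.
    set c := b %/ f in bE.
    have c_gt0 : 0 < c by case: (c) bE => //; lia.
    have ltc : c < q by rewrite -(ltn_pmul2r f_gt0) -bE.
    have aE : a = (q - c) * f by rewrite mulnBl; lia.
    have qcf : (q - c) * f + c * f = q * f by rewrite -mulnDl subnK // ltnW.
    have lta : q - c < q by lia.
    subst a; split=> [r ltr Br|r r' ltr _ Ar].
      by have := AB_inj (A_block _ _ Aa lta ltr) Bb A0 Br; nia.
    by have := AB_inj (A_block _ _ Aa lta ltr) Bb Ar B0; nia.
  have Aq : A (q * f) by have -> : q * f = a by lia.
  (* Now [q * f] is in [A], so [f] is a sum; a second summand below [f] would vanish and put [f]
     into [A]. *)
  have Bf : B f.
    have [|a' [b' [Aa' Bb' fE]]] := @AB_down _ _ f Aq B0; first by nia.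
    have [ltb'|geb'] := ltnP b' f; last by have -> : f = b' by lia.
    by case: A_notf; rewrite fE (B_small b') // addn0.
  (* For [r > 0], [(f - r) + (q * f + r)] would be a second representation of [q * f + f]. *)
  have B_no r : r < f -> B (q * f + r) -> r = 0.
    move=> ltr Br; have [//|r_gt0] := posnP r.
    have ltfr : f - r < f by lia.
    by have := AB_inj (A_initial ltfr) Br Aq Bf; nia.
  (* [q * f + r] lies below the sum [q * f + f], hence equals some [a' + b']. Any [b' > 0] leads to
     a second representation of [q * f]. *)
  split=> // _ r _ ltr _; have [->|r_gt0] := posnP r; first by rewrite addn0.
  have [|a' [b' [Aa' Bb' rE]]] := @AB_down _ _ (q * f + r) Aq Bf; first by lia.
  have [ltb'|geb'] := ltnP b' (q * f); last first.
    have b'E : b' = q * f + (b' - q * f) by lia.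
    have := B_no (b' - q * f); rewrite -b'E => /(_ _ Bb') b'0.
    have b'q : b' = q * f by lia.
    by rewrite b'q in Bb'; have := AB_inj Aq B0 A0 Bb'; nia.
  have b'E := B_dvd _ Bb' ltb'.
  have [c0|c_gt0] := posnP (b' %/ f).
    by have -> : q * f + r = a' by nia.
  set c := b' %/ f in b'E c_gt0.
  have ltc : c < q by rewrite -(ltn_pmul2r f_gt0) -b'E.
  have qcf : (q - c) * f + c * f = q * f by rewrite -mulnDl subnK // ltnW.
  have lta : q - c < q by lia.
  have a'E : a' = (q - c) * f + r by lia.
  have Ac : A ((q - c) * f).
    have := (IH _ lta).2 r 0; rewrite addn0; apply=> //; by rewrite -a'E.
  by have := AB_inj Ac Bb' Aq B0; nia.
split=> [r ltr Br|r r' ltr ltr' Ar].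
  by have [H _] := key r ltr (or_intror Br); exact: H.
by have [_ H] := key r ltr (or_introl Ar); exact: H Ar.
Qed.

End DirectSum.

(* An increasing enumeration of a union of aligned blocks of length [f]
   runs through the blocks one after the other. *)
Lemma enum_blocks (g : nat -> nat) (n f q : nat) :
    (forall a b, a < b -> b < n -> g a < g b) ->
    (forall c r r', r < f -> r' < f ->
      (exists2 t, t < n & g t = c * f + r) ->
      exists2 t, t < n & g t = c * f + r') ->
    0 < f -> q * f < n ->
  [/\ f %| g (q * f), q * f + f <= n &
      forall r, r < f -> g (q * f + r) = g (q * f) + r].
Proof.
move=> g_mono blocks f_gt0; elim/ltn_ind: q => q IH ltqn.
have g_inj a b : a < n -> b < n -> g a = g b -> a = b.
  by move=> lta ltb gab; case: (ltngtP a b) => // /g_mono; lia.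
have gE := divn_eq (g (q * f)) f.
set c := g (q * f) %/ f in gE; set r := g (q * f) %% f in gE.
have ltr : r < f by rewrite ltn_mod.
(* If [r > 0], the block start [c * f] is attained earlier, at the start of a previous block of
   indices. That block already attains [c * f + r], against injectivity. *)
have r0 : r = 0.
  have [//|r_gt0] := posnP r.
  have [|t ltt gt] := blocks c r 0 ltr f_gt0; first by exists (q * f).
  have ltt' : t < q * f.
    case: (ltngtP t (q * f)) => // [lt_t|tE]; last by subst t; lia.
    by have := g_mono _ _ lt_t ltt; lia.
  have tE := divn_eq t f.
  have ltq' : t %/ f < q by rewrite ltn_divLR.
  have [|dv le_n gr] := IH _ ltq'; first by lia.
  have ltr' : t %% f < f by rewrite ltn_mod.
  have gtE := gr _ ltr'; rewrite -tE gt addn0 in gtE.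
  have r'0 : t %% f = 0.
    by have := congr1 (modn^~ f) gtE; rewrite modnMl -modnDml (eqP dv) add0n modn_mod.
  rewrite r'0 addn0 in gtE tE.
  have := gr r ltr; rewrite -gtE -gE => /g_inj -/(_ _ ltqn); nia.
(* The value [g (q * f) + r'.+1] is attained beyond [q * f + r']. It must be at the very next index,
   since no integer lies between consecutive ones. *)
have gq r' : r' < f -> q * f + r' < n /\ g (q * f + r') = g (q * f) + r'.
  elim: r' => [|r' IHr] ltr'; first by rewrite !addn0.
  have [lt_n gr'] := IHr (ltnW ltr').
  have [|t ltt gt] := blocks c 0 r'.+1 f_gt0 ltr'.
    by exists (q * f) => //; lia.
  have lt_t : q * f + r' < t.
    case: (ltngtP (q * f + r') t) => // [lt_t|tE]; last by subst t; lia.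
    by have := g_mono _ _ lt_t lt_n; lia.
  have ltn : q * f + r'.+1 < n by lia.
  split=> //; have := g_mono (q * f + r') (q * f + r'.+1).
  have [tE|net] := eqVneq t (q * f + r'.+1); first by subst t; lia.
  have := g_mono (q * f + r'.+1) t; lia.
split; first by rewrite gE r0 addn0 dvdn_mull.
  by have [|+ _] := gq f.-1; lia.
by move=> r' /gq [].
Qed.

(** * Sum systems *)

Section SumSystem.

Variable m : nat.
Implicit Types (n p : dims m) (g : 'I_m -> nat -> nat) (i j : 'I_m).

Definition upd p j x : dims m := [ffun i => if i == j then x else p i].

(** Indices are plain vectors of naturals with a separate range condition, so changing the
    dimensions requires no transport. *)
Definition in_range n p := forall i, p i < n i.

Definition system_sum g p := \sum_i g i (p i).

Lemma upd_same p j x : upd p j x j = x. Proof. by rewrite ffunE eqxx. Qed.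

Lemma upd_id p j : upd p j (p j) = p.
Proof. by apply/ffunP => i; rewrite ffunE; case: eqP => // ->. Qed.

Lemma upd_upd p j x y : upd (upd p j x) j y = upd p j y.
Proof. by apply/ffunP => i; rewrite !ffunE; case: eqP. Qed.

Lemma in_range_upd n p j x : in_range n p -> x < n j -> in_range n (upd p j x).
Proof. by move=> rp ltx i; rewrite ffunE; case: eqP => [->|]. Qed.

Lemma system_sum_upd g p j x :
  system_sum g (upd p j x) = g j x + \sum_(i | i != j) g i (p i).
Proof.
rewrite /system_sum (bigD1 j) //= upd_same; congr (_ + _).
by apply: eq_bigr => i /negPf ij; rewrite ffunE ij.
Qed.

Lemma system_sum_split g p j :
  system_sum g p = g j (p j) + \sum_(i | i != j) g i (p i).
Proof. by rewrite -{1}(upd_id p j) system_sum_upd. Qed.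

(* The sets A_i = g_i({0, ..., n_i - 1}) sum directly to an initial segment. *)
Record sum_system n g : Prop := SumSystem {
  sys_pos : forall i, 0 < n i;
  sys_0 : forall i, g i 0 = 0;
  sys_mono : forall i a b, a < b -> b < n i -> g i a < g i b;
  sys_inj : forall p p', in_range n p -> in_range n p' ->
    system_sum g p = system_sum g p' -> p = p';
  sys_down : forall p x, in_range n p -> x <= system_sum g p ->
    exists2 p', in_range n p' & system_sum g p' = x }.

Definition zero_index : dims m := [ffun _ => 0].

Lemma system_sum_zero n g : sum_system n g -> system_sum g zero_index = 0.
Proof. by move=> sys; apply: big1 => i _; rewrite ffunE (sys_0 sys). Qed.

Lemma system_sum_single n g j x :
  sum_system n g -> system_sum g (upd zero_index j x) = g j x.
Proof.
move=> sys; rewrite system_sum_upd big1 ?addn0 // => i _.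
by rewrite ffunE (sys_0 sys).
Qed.

Lemma in_range_zero n g : sum_system n g -> in_range n zero_index.
Proof. by move=> sys i; rewrite ffunE (sys_pos sys). Qed.

(** * Division of a sum system by [f] in direction [j] *)

Section Peel.

Variables (n : dims m) (g : 'I_m -> nat -> nat) (j : 'I_m) (f : nat).
Hypothesis sys : sum_system n g.
Hypotheses (f_gt0 : 0 < f) (le_fn : f <= n j).
Hypothesis g_initial : forall r, r < f -> g j r = r.
Hypothesis g_notf : f < n j -> g j f != f.

Let A x := exists2 t, t < n j & g j t = x.
Let B x := exists2 p, in_range n p /\ p j = 0 & system_sum g p = x.

(** Separating coordinate [j] from the others turns the system into a direct sum of the two sets [A]
    and [B]. *)
Let sys_block q :
  (forall r, r < f -> B (q * f + r) -> r = 0) /\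
  (forall r r', r < f -> r' < f -> A (q * f + r) -> A (q * f + r')).
Proof.
have sumE p t : p j = 0 -> system_sum g (upd p j t) = g j t + system_sum g p.
  by move=> p0; rewrite system_sum_upd (system_sum_split g p j) p0 (sys_0 sys).
apply: direct_sum_block.
- by exists 0; rewrite ?(sys_pos sys) ?(sys_0 sys).
- exists zero_index; last exact: system_sum_zero sys.
  by split; [exact: in_range_zero sys | rewrite ffunE].
- move=> _ _ _ _ [t ltt <-] [p [rp p0] <-] [t' ltt' <-] [p' [rp' p'0] <-].
  rewrite -!sumE // => /(sys_inj sys) -/(_ (in_range_upd rp ltt)).
  by move=> /(_ (in_range_upd rp' ltt')) /ffunP /(_ j); rewrite !upd_same => ->.
- move=> _ _ x [t ltt <-] [p [rp p0] <-]; rewrite -sumE // => lex.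
  have [p' rp' <-] := sys_down sys (in_range_upd rp ltt) lex.
  exists (g j (p' j)), (system_sum g (upd p' j 0)); split.
  + by exists (p' j).
  + exists (upd p' j 0) => //; split; last by rewrite upd_same.
    exact: in_range_upd (sys_pos sys j).
  + by rewrite -sumE ?upd_same // upd_upd upd_id.
- by move=> r ltr; exists r; [exact: leq_trans le_fn | exact: g_initial].
(* [f] is not in [A]: indices below [f] give smaller values, index [f] is excluded by [g_notf], and
   later ones give more than [g j f], which is at least [f]. *)
- move=> [t ltt gt].
  have [ltf|gef] := ltnP t f; first by have := g_initial ltf; lia.
  have [|gtf] := leqP t f => [le_tf|].
    have tf : t = f by lia.
    by subst t; have := g_notf ltt; rewrite gt eqxx.
  have ltfn : f < n j by lia.
  have := sys_mono sys gtf ltt.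
  have := @sys_mono _ _ sys j f.-1 f.
  have := g_initial (r := f.-1); lia.
Qed.

(** An axis value in another direction lies in [B], so its remainder modulo [f] vanishes. *)
Lemma peel_dvd_other i a : i != j -> a < n i -> f %| g i a.
Proof.
move=> ij lta; apply/eqP/(sys_block (g i a %/ f)).1; first by rewrite ltn_mod.
rewrite -divn_eq; exists (upd zero_index i a).
  split; first exact: in_range_upd (in_range_zero sys) lta.
  by rewrite ffunE eq_sym (negPf ij) ffunE.
exact: system_sum_single sys.
Qed.

Lemma peel_block q : q * f < n j ->
  [/\ f %| g j (q * f), q * f + f <= n j &
      forall r, r < f -> g j (q * f + r) = g j (q * f) + r].
Proof.
apply: enum_blocks => //; first exact: (@sys_mono _ _ sys j).
by move=> c r r' ltr ltr'; apply: (sys_block c).2.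
Qed.

(** An incomplete last block of indices would, by [peel_block], have to fit completely below
    [n j]. *)
Lemma peel_dvd_size : f %| n j.
Proof.
have nE := divn_eq (n j) f.
have [r0|r_gt0] := posnP (n j %% f); first exact/eqP.
have := ltn_pmod (n j) f_gt0.
have [|_ + _] := @peel_block (n j %/ f); lia.
Qed.

Definition peel_dims : dims m := upd n j (n j %/ f).

(** Direction [j] keeps one index per block, its first. On the range all divisions are exact, by
    [peel_block] and [peel_dvd_other]. *)
Definition peel_fun i a := (if i == j then g j (a * f) else g i a) %/ f.

Definition scale_index p : dims m := upd p j (p j * f).

Definition peel_index p : dims m := upd p j (p j %/ f).

Lemma in_range_scale p : in_range peel_dims p -> in_range n (scale_index p).
Proof.
move=> rp i; have := rp i; rewrite !ffunE; case: eqP => // ->.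
by rewrite ltn_divRL // peel_dvd_size.
Qed.

Lemma in_range_peel p : in_range n p -> in_range peel_dims (peel_index p).
Proof.
move=> rp i; have := rp i; rewrite !ffunE; case: eqP => // -> ltp.
by rewrite ltn_divLR // divnK // peel_dvd_size.
Qed.

Lemma peel_scale p : peel_index (scale_index p) = p.
Proof. by rewrite /peel_index /scale_index upd_same upd_upd mulnK // upd_id. Qed.

Lemma system_sum_scale p : in_range peel_dims p ->
  system_sum g (scale_index p) = system_sum peel_fun p * f.
Proof.
move=> /in_range_scale rp; rewrite /system_sum big_distrl /=.
apply: eq_bigr => i _; have := rp i; rewrite /peel_fun !ffunE.
case: eqP => [-> ltp|/eqP ij ltp]; rewrite divnK //.
  by have [] := peel_block ltp.
exact: peel_dvd_other.
Qed.

(** This is the recursion that defines [build_value]: the offset inside the block is the lowest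
    digit. *)
Lemma system_sum_peel p : in_range n p ->
  system_sum g p = p j %% f + f * system_sum peel_fun (peel_index p).
Proof.
move=> rp; rewrite mulnC -system_sum_scale; last exact: in_range_peel.
rewrite /scale_index /peel_index upd_same upd_upd system_sum_upd addnA.
rewrite (system_sum_split g p j); congr (_ + _).
rewrite [RHS]addnC {1}(divn_eq (p j) f).
have [|_ _ ->] := @peel_block (p j %/ f); rewrite ?ltn_mod //.
exact: leq_ltn_trans (leq_trunc_div _ _) (rp j).
Qed.

Lemma sum_system_peel : sum_system peel_dims peel_fun.
Proof.
have nj_gt0 := sys_pos sys j.
split=> [i|i|i a b ltab|p p' rp rp' pp'|p x rp lex].
- rewrite ffunE; case: eqP => [_|_]; last exact: sys_pos sys i.
  by rewrite divn_gt0 // dvdn_leq // peel_dvd_size.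
- by rewrite /peel_fun mul0n !(sys_0 sys) if_same div0n.
- rewrite ffunE /peel_fun; case: eqP => [_|/eqP ij] ltb.
    rewrite ltn_divRL // in ltb; last exact: peel_dvd_size.
    have lta : a * f < b * f by rewrite ltn_pmul2r.
    have [dva _ _] := peel_block (ltn_trans lta ltb).
    by rewrite ltn_divLR // divnK; [exact: (sys_mono sys) | have [] := peel_block ltb].
  rewrite ltn_divLR // divnK; first exact: (sys_mono sys).
  exact: peel_dvd_other.
- rewrite -(peel_scale p) -(peel_scale p'); congr peel_index.
  apply: (sys_inj sys); rewrite ?system_sum_scale ?pp' //; exact: in_range_scale.
(* Represent [x * f] in the old system; the remainder of the index modulo [f] is then forced to be
   0, and dividing by [f] represents [x]. *)
- have lexf : x * f <= system_sum g (scale_index p).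
    by rewrite system_sum_scale // leq_mul2r lex orbT.
  have [p' rp' xE] := sys_down sys (in_range_scale rp) lexf.
  exists (peel_index p'); first exact: in_range_peel.
  have := ltn_pmod (p' j) f_gt0; move: xE; rewrite (system_sum_peel rp').
  move: (system_sum _ _) (p' j %% f) => y r; nia.
Qed.

End Peel.

(** * Entries of compositions of building operators *)

(* The value at [p] of the composition of the building operators of [s], where
   the head of [s] is applied first (see [foldl_packed_building]). *)
Fixpoint build_value (s : seq ('I_m * nat)) p : nat :=
  if s is (j, f) :: s' then p j %% f + f * build_value s' (upd p j (p j %/ f))
  else 0.

Definition build_dims (s : seq ('I_m * nat)) : dims m :=
  [ffun i => \prod_(x <- s | x.1 == i) x.2].

Lemma build_dims_cons j f s :
  build_dims ((j, f) :: s) = upd (build_dims s) j (f * build_dims s j).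
Proof.
apply/ffunP => i; rewrite !ffunE big_cons /= eq_sym; case: eqP => [->|//].
by congr (_ * _).
Qed.

Lemma build_dims_rcons j f s :
  build_dims (rcons s (j, f)) = kron_dims (build_dims s) j f.
Proof.
apply/ffunP => i; rewrite !ffunE big_rcons /= eq_sym.
by case: eqP => [->|_]; rewrite ?muln1 // mulnC.
Qed.

Lemma prod_build_dims s : \prod_i build_dims s i = \prod_(x <- s) x.2.
Proof.
under eq_bigr do rewrite ffunE.
rewrite (exchange_big_dep xpredT) //=; apply: eq_bigr => x _.
by rewrite (big_pred1 x.1) // => i; rewrite eq_sym.
Qed.

(** [build_value] strips the innermost operator, whereas [foldl] adds the outermost one. In
    mixed-radix terms the new operator contributes the top digit, and the bound on [p j] keeps this
    digit below [f]. *)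
Lemma build_value_rcons s j f p : p j < f * build_dims s j ->
  build_value (rcons s (j, f)) p =
    (\prod_(x <- s) x.2) * (p j %/ build_dims s j) +
    build_value s [ffun i => p i %% build_dims s i].
Proof.
elim: s p => [|[i h] s IH] p /=.
  rewrite ffunE !big_nil muln1 => ltp.
  by rewrite modn_small // muln0 divn1 mul1n.
rewrite build_dims_cons; move: (build_dims s) IH => d IH.
rewrite !ffunE => ltp.
rewrite IH; last first.
  rewrite ffunE; move: ltp; case: eqP => [->|//]; rewrite mulnCA => ltp.
  by rewrite ltn_divLR; [rewrite mulnC | lia].
rewrite big_cons /= mulnDr addnCA mulnA; congr (_ + _).
  congr (_ * _); rewrite ffunE; case: eqP => [->|//].
  by rewrite divnMA.
congr (_ + _ * build_value _ _); first by rewrite eqxx modn_dvdm // dvdn_mulr.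
apply/ffunP => k; rewrite !ffunE eqxx; case: eqP => [->|//].
by rewrite modn_divl mulnC.
Qed.

(** Entries are compared through the numerical coordinates of [k], so the equality of dimensions
    need not be used as a cast. *)
Lemma foldl_packed_building s :
  let C := foldl (@packed_building m) (pack (trivial_cuboid m)) s in
  tag C = build_dims s /\
  forall k : cindex (tag C),
    tagged C k = build_value s [ffun i => k i : nat].
Proof.
elim/last_ind: s => [|s [j f] /=].
  by split=> [|k]; [apply/ffunP => i; rewrite !ffunE big_nil | rewrite /= ffunE].
rewrite foldl_rcons; case: (foldl _ _ s) => n N /= [nE NE].
rewrite build_dims_rcons -nE; split=> // p.
have ltp : p j < f * n j by have := ltn_ord (p j); rewrite {2}ffunE eqxx.
rewrite build_value_rcons -nE; last by rewrite ffunE.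
rewrite -prod_build_dims -nE !ffunE /=.
(* The Kronecker digit is in range, so neither [nth] falls back on its default 0. *)
have ltf : p j %/ n j < f by rewrite ltn_divLR //; lia.
rewrite nth_iota // [kron _ _ _ _]ffunE /= nth_nseq ltf.
rewrite [X in _ * (_ * X) + _]ffunE [X in _ = _ * (X %/ _) + _]ffunE.
rewrite add0n muln1 mul1n NE; congr (_ + build_value _ _).
apply/ffunP => i; rewrite [LHS]ffunE [RHS]ffunE [kron_index p i]ffunE /=.
by rewrite [X in _ = X %% _]ffunE.
Qed.

(** * Factorisation of sum systems *)

Lemma sum_system_factor n g : sum_system n g ->
  exists s : seq ('I_m * nat),
    [/\ all (fun x => 1 < x.2) s, build_dims s = n,
        forall p, in_range n p -> system_sum g p = build_value s p,
        sorted (fun x y => y.1 != x.1) s &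
        if s is x :: _ then 1 < n x.1 /\ g x.1 1 = 1 else True].
Proof.
have [N] := ubnP (\sum_i n i).
elim: N => // N IH in n g * => ltN sys.
have [/forallP n1|] := boolP [forall i, n i == 1].
  exists [::]; split=> //.
    by apply/ffunP => i; rewrite ffunE big_nil (eqP (n1 i)).
  move=> p rp; rewrite [RHS]/= -(system_sum_zero sys); congr system_sum.
  by apply/ffunP => i; have := rp i; rewrite ffunE (eqP (n1 i)); case: (p i).
rewrite negb_forall => /existsP[i0 ni0].
have ni0_gt1 : 1 < n i0 by have := sys_pos sys i0; lia.
(* Since 1 lies below an attained sum it is attained; a nonzero coordinate of its index has axis
   value at most 1, which forces that coordinate to be 1. *)
have [j [nj_gt1 gj1]] : exists j, 1 < n j /\ g j 1 = 1.
  have ge1 : 1 <= system_sum g (upd zero_index i0 1).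
    rewrite (system_sum_single _ _ sys); have := sys_mono sys (ltnSn 0) ni0_gt1; lia.
  have [p rp p1] := sys_down sys (in_range_upd (in_range_zero sys) ni0_gt1) ge1.
  have [j pj] : exists j, p j != 0.
    apply/existsP; apply: contraT; rewrite negb_exists => /forallP p0.
    suff pz : p = zero_index by rewrite pz (system_sum_zero sys) in p1.
    by apply/ffunP => i; rewrite ffunE; have := p0 i; rewrite negbK => /eqP.
  exists j; have ltp := rp j; have nj_gt1 : 1 < n j by lia.
  split=> //; have := sys_mono sys (ltnSn 0) nj_gt1; rewrite (sys_0 sys).
  have : g j (p j) <= 1 by rewrite -p1 (system_sum_split g p j) leq_addr.
  have [->|npj1] := eqVneq (p j) 1; first by lia.
  have := @sys_mono _ _ sys j 1 (p j); lia.
(* The factor is the largest [f] for which axis [j] begins with [0, ..., f - 1]; maximality supplies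
   [g_notf]. *)
pose P f := (f <= n j) && [forall r : 'I_f, g j r == r].
have P2 : P 2.
  rewrite /P nj_gt1; apply/forallP => -[[|[|//]] ltr] /=; first by rewrite (sys_0 sys).
  by rewrite gj1.
have Pmax f : P f -> f <= n j by case/andP.
case: (ex_maxnP (ex_intro P 2 P2) Pmax) => f /andP[le_fn /forallP g_init] f_max.
have f_gt1 := f_max 2 P2; have f_gt0 := ltnW f_gt1.
have g_initial r : r < f -> g j r = r by move=> ltr; apply/eqP/(g_init (Ordinal ltr)).
have g_notf : f < n j -> g j f != f.
  move=> ltf; apply/eqP => gf; suff /f_max : P f.+1 by rewrite ltnn.
  rewrite /P ltf; apply/forallP => -[r /= ltr]; apply/eqP.
  by have [/g_initial|le_fr] := ltnP r f; last have -> : r = f by lia.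
have dvf := peel_dvd_size sys f_gt0 le_fn g_initial g_notf.
have sys' := sum_system_peel sys f_gt0 le_fn g_initial g_notf.
have [|s [s_all s_dims s_val s_sort s_head]] := IH _ _ _ sys'.
  apply: leq_trans (ltN : _ <= N); rewrite (bigD1 j) //= [X in _ < X](bigD1 j) //=.
  rewrite upd_same (eq_bigr n) ?ltn_add2r ?ltn_Pdiv ?(sys_pos sys) //.
  by move=> i /negPf ij; rewrite ffunE ij.
exists ((j, f) :: s); split=> //=; first by rewrite f_gt1.
- rewrite build_dims_cons s_dims upd_same upd_upd mulnC divnK //.
  exact: upd_id.
- move=> p rp.
  rewrite (system_sum_peel sys f_gt0 le_fn g_initial g_notf rp) s_val //.
  exact: (in_range_peel sys f_gt0 le_fn g_initial g_notf rp).
(* The clause on the head of [s] is carried through the induction for this point: a next direction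
   equal to [j] would give [g j f %/ f = 1], hence [g j f = f] by divisibility, against
   maximality. *)
- case: s s_sort s_head {s_all s_dims s_val} => //= x s -> [x_n x_g].
  rewrite andbT; apply/eqP => xj; move: x_n x_g.
  rewrite xj upd_same /peel_fun eqxx mul1n ltn_divRL // mul1n => ltf gf.
  have [|dv _ _] := @peel_block _ _ _ _ sys f_gt0 le_fn g_initial g_notf 1.
    by rewrite mul1n.
  rewrite mul1n in dv; have := g_notf ltf.
  by rewrite -(divnK dv) gf mul1n eqxx.
Qed.

End SumSystem.

(** * Principal reversible cuboids as sum systems *)

Section Reversible.

Variables (m : nat) (n : dims m) (M : cuboid n).
Hypothesis n_gt0 : forall i, 0 < n i.
Hypothesis M_rev : principal_reversible M.

Let k0 : cindex n := [ffun i => Ordinal (n_gt0 i)].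

Definition index_val (k : cindex n) : dims m := [ffun i => k i : nat].

(** Defined on all naturals to match [sum_system], with value 0 out of range. The truncated
    subtraction is exact by [set_coord_le]. *)
Definition axis_value i a : nat :=
  if insub a is Some a' then M (set_coord k0 (a' : 'I_(n i))) - M k0 else 0.

Lemma index_val_inj : injective index_val.
Proof.
move=> k k' /ffunP kk'; apply/ffunP => i; apply/val_inj.
by have := kk' i; rewrite !ffunE.
Qed.

Lemma index_val_set (k : cindex n) i (a : 'I_(n i)) :
  index_val (set_coord k a) = upd (index_val k) i a.
Proof.
apply/ffunP => i'; rewrite !ffunE; case: eqVneq => [->|ne].
  by rewrite dfwith_in.
by rewrite dfwith_out // eq_sym.
Qed.

Lemma index_val_onto p : in_range n p -> exists k, index_val k = p.
Proof.
move=> rp; exists [ffun i => Ordinal (rp i)].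
by apply/ffunP => i; rewrite !ffunE.
Qed.

Lemma index_val_range k : in_range n (index_val k).
Proof. by move=> i; rewrite ffunE. Qed.

Lemma index_val0 : index_val k0 = zero_index m.
Proof. by apply/ffunP => i; rewrite !ffunE. Qed.

Lemma set_coord_le i (a : 'I_(n i)) : M k0 <= M (set_coord k0 a).
Proof.
have [_ _ M_mono] := M_rev.
have [a0|a_gt0] := posnP a; last by apply/ltnW/M_mono; rewrite ffunE.
suff -> : set_coord k0 a = k0 by [].
apply: index_val_inj; rewrite index_val_set a0 index_val0.
by apply/ffunP => i'; rewrite !ffunE; case: eqP.
Qed.

Lemma axis_valueE i (a : 'I_(n i)) :
  M (set_coord k0 a) = M k0 + axis_value i a.
Proof. by rewrite /axis_value valK subnKC // set_coord_le. Qed.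

Lemma axis_value0 i : axis_value i 0 = 0.
Proof.
have := axis_valueE (Ordinal (n_gt0 i)); rewrite /=.
suff -> : set_coord k0 (Ordinal (n_gt0 i)) = k0 by lia.
apply: index_val_inj; rewrite index_val_set index_val0.
by apply/ffunP => i'; rewrite !ffunE; case: eqP.
Qed.

(* Property (V), applied at two nonzero coordinates and 0, expresses an entry
   through entries whose index has fewer nonzero coordinates. *)
Lemma cuboid_sum k : M k = M k0 + system_sum axis_value (index_val k).
Proof.
have [MV _ _] := M_rev.
have [N] := ubnP #|[pred i | k i != 0 :> nat]|.
elim: N => // N IH in k * => ltN.
have [i ki|kz] := pickP [pred i | k i != 0 :> nat]; last first.
  have -> : k = k0.
    apply: index_val_inj; rewrite index_val0; apply/ffunP => i.
    by rewrite !ffunE; have /negbFE/eqP := kz i.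
  by rewrite index_val0 /system_sum big1 ?addn0 // => i _; rewrite ffunE axis_value0.
have [j /andP[kj ji]|kz] := pickP [pred j | (k j != 0 :> nat) && (j != i)]; last first.
  have kE : index_val k = upd (zero_index m) i (k i).
    apply/ffunP => j; rewrite !ffunE; have := kz j; rewrite /=.
    by case: (eqVneq j i) => [->|_] //; rewrite andbT => /negbFE/eqP.
  have -> : k = set_coord k0 (k i).
    by apply: index_val_inj; rewrite index_val_set index_val0.
  rewrite axis_valueE index_val_set index_val0 system_sum_upd big1 ?addn0 //.
  by move=> j _; rewrite ffunE axis_value0.
(* [propertyV] is stated for [i < j] only, and the two coordinates play symmetric roles. *)
wlog ltij : i j ki kj ji / i < j.
  move=> H; case: (ltngtP i j) => [|gtij|/val_inj ij]; first exact: H.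
    by apply: (H j i); rewrite // eq_sym.
  by rewrite ij eqxx in ji.
pose zi := Ordinal (n_gt0 i); pose zj := Ordinal (n_gt0 j).
have lt_set (k' : cindex n) l : (forall l', k l' = 0 :> nat -> k' l' = 0 :> nat) ->
    k l != 0 :> nat -> k' l = 0 :> nat -> #|[pred i | k' i != 0 :> nat]| < N.
  move=> sub kl k'l; apply: leq_trans (ltN : _ <= N); apply: proper_card.
  apply/properP; split; last by exists l; rewrite !inE ?k'l.
  by apply/subsetP => l'; rewrite !inE; apply: contraNN => /eqP/sub/eqP.
have valE (k' : cindex n) l : k' l = index_val k' l :> nat by rewrite ffunE.
have IHi : M (set_coord k zi) =
    M k0 + system_sum axis_value (upd (index_val k) i 0).
  rewrite IH ?index_val_set //; apply: (@lt_set _ i) => // [l kl|].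
    by rewrite valE index_val_set !ffunE kl; case: eqP.
  by rewrite valE index_val_set upd_same.
have IHj : M (set_coord k zj) =
    M k0 + system_sum axis_value (upd (index_val k) j 0).
  rewrite IH ?index_val_set //; apply: (@lt_set _ j) => // [l kl|].
    by rewrite valE index_val_set !ffunE kl; case: eqP.
  by rewrite valE index_val_set upd_same.
have IHij : M (set_coord (set_coord k zi) zj) =
    M k0 + system_sum axis_value (upd (upd (index_val k) i 0) j 0).
  rewrite IH ?index_val_set //; apply: (@lt_set _ j) => // [l kl|].
    by rewrite valE !index_val_set !ffunE kl; case: eqP => //; case: eqP.
  by rewrite valE !index_val_set upd_same.
have := MV i j ltij k zi zj; rewrite IHi IHj IHij.
rewrite !(system_sum_upd _ _ j) (system_sum_split _ (index_val k) j).
rewrite (system_sum_split _ (upd (index_val k) i 0) j) [upd _ _ _ j]ffunE.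
rewrite (negPf ji); lia.
Qed.

(** By [cuboid_sum] no entry is below [M k0], and 0 is an entry. *)
Lemma cuboid0 : M k0 = 0.
Proof.
have [_ M_im _] := M_rev; have /M_im[k] : 0 < \prod_j n j by rewrite prodn_gt0.
by rewrite cuboid_sum; lia.
Qed.

(** [M] maps onto a set with as many elements as there are indices. *)
Lemma cuboid_inj : injective M.
Proof.
have [_ M_im _] := M_rev.
have ltM k : M k < \prod_j n j by apply/M_im; exists k.
pose F k := Ordinal (ltM k).
suff F_inj : injective F by move=> k k' kk'; apply: F_inj; apply: val_inj.
have cardE' : #|{: cindex n}| = #|'I_(\prod_j n j)|.
  rewrite card_ord card_dep_ffun foldrE big_image /=.
  by apply: eq_bigr => i _; rewrite card_ord.
suff /image_injP F_inj : #|image F predT| == #|{: cindex n}|.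
  by move=> k k' kk'; apply: F_inj.
rewrite cardE'; apply/eqP/eq_card => x; rewrite inE; apply/imageP.
have /M_im[k kx] := ltn_ord x; exists k => //; exact: val_inj.
Qed.

Lemma cuboid_sum_system : sum_system n axis_value.
Proof.
have [MV M_im M_mono] := M_rev.
have sumE k : system_sum axis_value (index_val k) = M k.
  by rewrite cuboid_sum cuboid0.
split=> //; first exact: axis_value0.
- move=> i a b ltab ltb; pose b' := Ordinal ltb.
  pose a' := Ordinal (ltn_trans ltab ltb).
  have := axis_valueE b'; have := axis_valueE a'; rewrite /= cuboid0 !add0n => <- <-.
  (* Monotonicity of [M] compares an index with a modification of it, so the larger index is
     rewritten as one. *)
  have -> : set_coord k0 b' = set_coord (set_coord k0 a') b'.
    by apply: index_val_inj; rewrite !index_val_set upd_upd.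
  have lt : set_coord k0 a' i < b'.
    have -> : set_coord k0 a' i = index_val (set_coord k0 a') i :> nat.
      by rewrite [RHS]ffunE.
    by rewrite index_val_set upd_same.
  exact: M_mono.
- move=> _ _ /index_val_onto[k <-] /index_val_onto[k' <-].
  by rewrite !sumE => /cuboid_inj ->.
- move=> _ x /index_val_onto[k <-]; rewrite sumE => lex.
  have /M_im[k' <-] : x < \prod_j n j.
    by apply: leq_ltn_trans lex _; apply/M_im; exists k.
  by exists (index_val k'); [exact: index_val_range | exact: sumE].
Qed.

End Reversible.

(** * The factorisation theorem *)

Theorem theorem8 (m : nat) (n : dims m) (M : cuboid n)
    (hm : 0 < m) (hn : forall j : 'I_m, 0 < n j)
    (hM : principal_reversible M) :
  exists (L : nat) (j : 'I_L -> 'I_m) (f : 'I_L -> nat),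
    [/\ forall l : 'I_L, 2 <= f l,
        forall i : 'I_m, \prod_(l < L | j l == i) f l = n i,
        pack M = building_comp j f (pack (trivial_cuboid m)) &
        forall l l' : 'I_L, l' = l.+1 :> nat -> j l' <> j l].
Proof.
have [s [s_all s_dims s_val s_sort _]] := sum_system_factor (cuboid_sum_system hn hM).
pose t := tnth (in_tuple s).
exists (size s), (fun l => (t l).1), (fun l => (t l).2); split.
- by move=> l; apply: (allP s_all); exact: mem_tnth.
- move=> i; rewrite -s_dims ffunE (big_tnth _ _ s).
  exact: eq_bigl.
- rewrite /building_comp.
  have -> : [seq ((t l).1, (t l).2) | l <- enum 'I_(size s)] = s.
    rewrite -[RHS](map_tnth_enum (in_tuple s)).
    by apply: eq_map => l; rewrite -surjective_pairing.
  (* With the packed result destructed, its dimension vector is a variable that [subst] can identify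
     with that of [M]; only entries remain to be compared. *)
  case: (foldl_packed_building s); case: (foldl _ _ s) => n' M' /= n'E M'E.
  rewrite s_dims in n'E; subst n'; congr pack.
  apply/ffunP => k; rewrite M'E -s_val; last exact: index_val_range.
  by rewrite (cuboid_sum hn hM) (cuboid0 hn hM).
- move=> l l' l'l; apply/eqP; have := ltn_ord l'; rewrite l'l => lt_l.
  pose x0 := t l; have := sortedP x0 s_sort l lt_l.
  by rewrite /t !(tnth_nth x0) l'l.
Qed.
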